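(* Fix $p\in(0,1]$. Let $G=(G_i)_{i\in\mathbb{Z}}$ be a sequence of random variables taking values in $\mathbb{Z}$. The following are equivalent: (P1) $(G_i)_{i\in\mathbb{Z}}$ is a family of independent $\mathrm{Geom}_+(p)$ random variables; (P2) $(G_i)_{i\ge0}$ is a family of independent $\mathrm{Geom}_+(p)$ random variables, and $\Phi_n(G)\overset{d}{=}G$ for every integer $n\ge0$.
   Context: $\mathrm{Geom}_+(p)$: $\mathbb{P}(G=k)=(1-p)^{k-1}p$ for $k\ge1$. For an integer sequence $g=(g_i)_{i\in\mathbb{Z}}$ and $n\ge0$, let $s_n=\min\{i\ge0:g_0+\dots+g_i>n\}$ (assumed finite, which holds when $g_i\ge1$ for $i\ge0$). Define $\Phi_n(g)=(\phi_i)_{i\in\mathbb{Z}}$ by: $\phi_i=g_{s_n+i}$ for $i\ge1$; $\phi_0=\sum_{j=0}^{s_n}g_j-n$; and, if $s_n\ge1$: $\phi_{-1}=n+1-\sum_{j=0}^{s_n-1}g_j$, $\phi_i=g_{s_n+i+1}$ for $-s_n\le i\le-2$, $\phi_{-s_n-1}=g_0+g_{-1}-1$, $\phi_i=g_{s_n+i}$ for $i\le-s_n-2$; if $s_n=0$: $\phi_{-1}=n+g_{-1}$ and $\phi_i=g_i$ for $i\le-2$. *)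

(* Defs.v *)
From HB Require Import structures.
From mathcomp Require Import all_boot all_order all_algebra.
From mathcomp Require Import all_classical all_reals all_analysis.
Set Implicit Arguments. Unset Strict Implicit. Unset Printing Implicit Defensive.
Import Order.TTheory GRing.Theory Num.Theory.
Local Open Scope classical_set_scope.
Local Open Scope ring_scope.

Definition geom_pmf (R : realType) (p : R) (k : int) : R :=
  if (0 < k)%R then (1 - p) ^+ (absz k).-1 * p else 0.

Definition psum (g : int -> int) (i : nat) : int :=
  \sum_(0 <= j < i.+1) g (j%:Z).

(* s_n = min{i >= 0 : g_0+...+g_i > n}; when g_i >= 1 for i >= 0 this is <= n,
   so the search over 0..n is exhaustive; otherwise a default value n+1 is used
   (this case only occurs on a null event in the theorem). *)
Definition s_n (n : nat) (g : int -> int) : nat :=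
  find (fun i => (n%:Z < psum g i)%R) (iota 0 n.+1).

Definition Phi (n : nat) (g : int -> int) : int -> int := fun i =>
  let s := s_n n g in
  let S := s%:Z in
  if (1 <= i)%R then g (S + i)
  else if i == 0 then psum g s - n%:Z
  else if s == 0%N then
    (if i == -1 then n%:Z + g (-1) else g i)
  else if i == -1 then n%:Z + 1 - psum g s.-1
  else if (- S <= i)%R then g (S + i + 1)
  else if i == - S - 1 then g 0 + g (-1) - 1
  else g (S + i).

Section Prob.
Context (R : realType) (d : measure_display) (T : measurableType d)
        (P : probability T R).

Definition cyl (X : int -> T -> int) (s : seq int) (v : int -> int) : set T :=
  [set w | all (fun i => X i w == v i) s].

Definition indep_on (A : set int) (X : int -> T -> int) : Prop :=
  forall (s : seq int) (v : int -> int), uniq s -> (forall i, i \in s -> A i) ->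
    P (cyl X s v) = (\prod_(i <- s) P (cyl X [:: i] v))%E.

Definition iid_geom (p : R) (A : set int) (X : int -> T -> int) : Prop :=
  indep_on A X /\
  forall i, A i -> forall k : int, P (X i @^-1` [set k]) = (geom_pmf p k)%:E.

(* equality in distribution of Z^Z-valued processes (finite-dimensional laws) *)
Definition eqd (X Y : int -> T -> int) : Prop :=
  forall (s : seq int) (v : int -> int), P (cyl X s v) = P (cyl Y s v).

End Prob.

(* Main.v *)
Require Import Defs.
From mathcomp Require Import all_boot all_order all_algebra.
From mathcomp Require Import all_classical all_reals all_analysis.
From mathcomp Require Import zify ring lra.
Set Implicit Arguments. Unset Strict Implicit. Unset Printing Implicit Defensive.
Import Order.TTheory GRing.Theory Num.Theory.
Local Open Scope classical_set_scope.
Local Open Scope ring_scope.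

(* When g_i >= 1 for all i >= 0, Phi_n is the n-th iterate of Phi_1, and Phi_1
   shifts g to the left if g_0 = 1 and otherwise moves one unit from g_0 to
   g_{-1}.  Hence, for a finite set s of sites containing 0 and -1 and values v
   with v_0 >= 1,
     P(Phi_1(G) = v on s) = [v_{-1} = 1] P(G_{i+1} = v_i, i in s)
                            + P(G = v' on s),
   where v' is v with v_0 raised and v_{-1} lowered by one.  For i.i.d. geometric
   G the right-hand side is the product of the weights of v, so Phi_1, hence
   Phi_n, preserves the law.  Conversely, if Phi_1(G) and G have the same law,
   the identity is a recursion for the law of G: it gives probability 0 when
   v_{-1} <= 0, since v_0 then grows without bound, and for v_{-1} = k >= 1 it
   reduces, after k steps, the law on sites >= -m-1 to the law on sites >= -m. *)

(** * Pathwise dynamics: [Phi] as an iterate of [unit_shift] *)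

Definition unit_shift (g : int -> int) : int -> int := fun i =>
  if g 0 == 1 then g (i + 1)
  else if i == 0 then g 0 - 1
  else if i == -1 then g (-1) + 1
  else g i.

Definition pos_right (g : int -> int) := forall j : nat, 1 <= g j%:Z.

Lemma psum0 g : psum g 0 = g 0.
Proof. by rewrite /psum big_nat1. Qed.

Lemma psumS g i : psum g i.+1 = psum g i + g i.+1%:Z.
Proof. by rewrite /psum big_nat_recr. Qed.

Lemma psum_ge g i : pos_right g -> i%:Z + 1 <= psum g i.
Proof.
move=> gp; elim: i => [|i IHi]; first by rewrite psum0; have : 1 <= g 0 := gp 0%N; lia.
by rewrite psumS; have := gp i.+1; lia.
Qed.

Lemma s_n_spec n g : pos_right g ->
  n%:Z < psum g (s_n n g) /\ (forall t, (t < s_n n g)%N -> psum g t <= n%:Z).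
Proof.
move=> gp; rewrite /s_n.
set a := fun i => _; set l := iota 0 n.+1.
have ha : has a l.
  (* Entries at least 1 force [psum g n] to be at least n+1, so the search succeeds by index n and
     the default value of [find] never occurs. *)
  apply/hasP; exists n; first by rewrite mem_iota; lia.
  by rewrite /a; have := psum_ge n gp; lia.
have lt : (find a l < n.+1)%N by rewrite -(size_iota 0 n.+1) -has_find.
split; first by have := nth_find 0%N ha; rewrite nth_iota.
move=> t ht; have := before_find 0%N ht.
by rewrite nth_iota ?add0n /a //; lia.
Qed.

Lemma s_n_unique n g s : pos_right g ->
  n%:Z < psum g s -> (forall t, (t < s)%N -> psum g t <= n%:Z) -> s_n n g = s.
Proof.
move=> gp h1 h2; have [k1 k2] := s_n_spec n gp.
case: (ltngtP (s_n n g) s) => // [/h2|/k2]; lia.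
Qed.

Lemma Phi0 g : pos_right g -> Phi 0 g =1 g.
Proof.
move=> gp i; have g0 : 1 <= g 0 := gp 0%N.
have s0 : s_n 0 g = 0%N by apply: s_n_unique => //; rewrite psum0; lia.
rewrite /Phi s0 psum0 /=.
case: ifP => h1; first by congr g; lia.
case: eqP => [->|h2]; first by lia.
by case: eqP => [->|h3] //; lia.
Qed.

Lemma unit_shift_pos g : pos_right g -> pos_right (unit_shift g).
Proof.
move=> gp j; rewrite /unit_shift; have g0 : 1 <= g 0 := gp 0%N.
case: eqP => [_|h]; first by have := gp j.+1; rewrite -addn1 PoszD.
case: eqP => h1; first by lia.
case: eqP => h2; [by lia|exact: gp].
Qed.

Lemma psum_unit_shift1 g i : g 0 = 1 -> psum (unit_shift g) i = psum g i.+1 - 1.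
Proof.
move=> g0; elim: i => [|i IHi].
  by rewrite psumS !psum0 /unit_shift g0 eqxx add0r addrAC subrr add0r.
rewrite psumS IHi [psum g i.+2]psumS /unit_shift g0 eqxx.
by rewrite (_ : i.+1%:Z + 1 = i.+2%:Z); lia.
Qed.

Lemma psum_unit_shift g i : g 0 != 1 -> psum (unit_shift g) i = psum g i - 1.
Proof.
move=> g0; elim: i => [|i IHi].
  by rewrite !psum0 /unit_shift (negbTE g0).
by rewrite psumS IHi psumS {1}/unit_shift (negbTE g0) /=; lia.
Qed.

(** Either branch of [unit_shift] takes exactly one unit from the sites i >= 0, so g crosses level
    n+1 where its image crosses level n, up to the index shift when g 0 = 1. The defining cases then
    match one by one. *)
Lemma Phi_succ n g : pos_right g -> Phi n.+1 g =1 Phi n (unit_shift g).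
Proof.
move=> gp i; have hp := unit_shift_pos gp; have g0p : 1 <= g 0 := gp 0%N.
have [k1 k2] := s_n_spec n hp.
case: (boolP (g 0 == 1)) => [/eqP g0|g0].
- have sE : s_n n.+1 g = (s_n n (unit_shift g)).+1.
    apply: s_n_unique => //.
      by move: k1; rewrite psum_unit_shift1 //; lia.
    case=> [|t] ht; first by rewrite psum0; lia.
    by have := k2 t ht; rewrite psum_unit_shift1 //; lia.
  have pE := fun i => psum_unit_shift1 i g0.
  have hE : forall j, unit_shift g j = g (j + 1).
    by move=> j; rewrite /unit_shift g0 eqxx.
  rewrite /Phi sE; set s := s_n n _; rewrite pE !hE /=.
  case: ifP => h1; first by congr g; lia.
  case: eqP => h2; first by lia.
  case: eqP => h3.
    case: eqP => h4; first by rewrite h4 psum0 ?g0; lia.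
    by rewrite pE prednK; lia.
  case: ifP => h4.
    case: eqP => h5; first by lia.
    case: ifP => h6; first by congr g; lia.
    (* Here i = -s-1, the site where [Phi n] of the image merges two entries; since g 0 = 1, the
       merged value g 1 + g 0 - 1 is just g 1. *)
    rewrite ifT; last by lia.
    rewrite addNr g0 addrK; congr g; lia.
  case: eqP => h5.
    rewrite g0 (_ : 1 + _ - 1 = g (-1)); last by lia.
    case: eqP => h6; first by congr g; lia.
    by rewrite !ifF; [congr g; lia|lia|lia].
  case: eqP => h6; first by congr g; lia.
  by rewrite !ifF; [congr g; lia|lia|lia].
(* The removed unit comes off g 0 without moving any site, so the crossing index is unchanged. *)
- have sE : s_n n.+1 g = s_n n (unit_shift g).
    apply: s_n_unique => //.
      by move: k1; rewrite psum_unit_shift //; lia.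
    move=> t ht.
    by have := k2 t ht; rewrite psum_unit_shift //; lia.
  have pE := fun i => psum_unit_shift i g0.
  have hE : forall j, j != 0 -> j != -1 -> unit_shift g j = g j.
    by move=> j /negbTE j0 /negbTE j1; rewrite /unit_shift (negbTE g0) j0 j1.
  have h0 : unit_shift g 0 = g 0 - 1 by rewrite /unit_shift (negbTE g0).
  have hm : unit_shift g (-1) = g (-1) + 1 by rewrite /unit_shift (negbTE g0).
  rewrite /Phi sE; set s := s_n n _; rewrite !pE h0 hm /=.
  case: ifP => h1; first by rewrite hE; lia.
  case: eqP => h2; first by lia.
  case: eqP => h3.
    by case: eqP => h4; [lia|rewrite hE; lia].
  case: eqP => h4; first by lia.
  case: ifP => h5; first by rewrite hE; lia.
  case: eqP => h6; first by lia.
  by rewrite hE; lia.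
Qed.

Lemma Phi1 g : pos_right g -> Phi 1 g =1 unit_shift g.
Proof. by move=> gp i; rewrite Phi_succ // Phi0 //; exact: unit_shift_pos. Qed.

(** * Random variables with countably many values *)

Section DiscreteMeasurability.
Context (d : measure_display) (T : measurableType d).

Definition discrete_rv (U : countType) (f : T -> U) :=
  forall u, measurable (f @^-1` [set u]).

(** Splitting over the countably many values of f freezes the parameter of F. This handles [Phi],
    which reads the process at a random site. *)
Lemma discrete_rv_bind (U V : countType) (f : T -> U) (F : U -> T -> V) :
  discrete_rv f -> (forall u, discrete_rv (F u)) ->
  discrete_rv (fun w => F (f w) w).
Proof.
move=> mf mF y.
have -> : (fun w => F (f w) w) @^-1` [set y] =
    \bigcup_u (f @^-1` [set u] `&` F u @^-1` [set y]).
  apply/seteqP; split => w /=; first by move=> <-; exists (f w).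
  by move=> [u _ [/= <-]].
apply: countable_bigcupT_measurable; first exact: countableP.
by move=> u; apply: measurableI; [exact: mf|exact: mF].
Qed.

Lemma discrete_rv_cst (U : countType) (u : U) : discrete_rv (fun=> u).
Proof.
move=> y; case: (pselect (u = y)) => [->|uy].
  by rewrite (_ : _ @^-1` _ = setT) //; apply/seteqP; split.
by rewrite (_ : _ @^-1` _ = set0) //; apply/seteqP; split.
Qed.

Lemma discrete_rv_comp (U V : countType) (h : U -> V) (f : T -> U) :
  discrete_rv f -> discrete_rv (fun w => h (f w)).
Proof.
move=> mf; apply: (discrete_rv_bind (F := fun u _ => h u)) => // u.
exact: discrete_rv_cst.
Qed.

Lemma discrete_rv_comp2 (U V W : countType) (h : U -> V -> W)
    (f : T -> U) (g : T -> V) :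
  discrete_rv f -> discrete_rv g -> discrete_rv (fun w => h (f w) (g w)).
Proof.
move=> mf mg; apply: (discrete_rv_bind (F := fun u w => h u (g w))) => // u.
exact: discrete_rv_comp.
Qed.

Variable X : int -> T -> int.
Hypothesis mX : forall i, discrete_rv (X i).

Lemma discrete_rv_psum n : discrete_rv (fun w => psum (X^~ w) n).
Proof.
elim: n => [|n IHn].
  by under eq_fun do rewrite psum0; exact: mX.
under eq_fun do rewrite psumS.
exact: (discrete_rv_comp2 +%R).
Qed.

Lemma discrete_rv_s_n n : discrete_rv (fun w => s_n n (X^~ w)).
Proof.
(* The index [s_n] is a function of a finite list of partial sums, and such lists form a countable
   type. *)
pose psums l w := [seq psum (X^~ w) i | i <- l].
have mpsums l : discrete_rv (psums l).
  elim: l => [|i l IHl]; first exact: discrete_rv_cst.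
  exact: (discrete_rv_comp2 cons (discrete_rv_psum i) IHl).
have -> : (fun w => s_n n (X^~ w)) =
    (fun w => find (fun x => n%:Z < x) (psums (iota 0 n.+1) w)).
  by apply/funext => w; rewrite /s_n /psums find_map.
exact: discrete_rv_comp.
Qed.

Lemma discrete_rv_Phi n i : discrete_rv (fun w => Phi n (X^~ w) i).
Proof.
(* The body of [Phi] with the crossing index frozen at s. *)
pose F s w :=
  let S := s%:Z in
  if (1 <= i)%R then X (S + i) w
  else if i == 0 then psum (X^~ w) s - n%:Z
  else if s == 0%N then
    (if i == -1 then n%:Z + X (-1) w else X i w)
  else if i == -1 then n%:Z + 1 - psum (X^~ w) s.-1
  else if (- S <= i)%R then X (S + i + 1) w
  else if i == - S - 1 then X 0 w + X (-1) w - 1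
  else X (S + i) w.
apply: (discrete_rv_bind (F := F) (discrete_rv_s_n n)) => s; rewrite /F /=.
case: (1 <= i); first exact: mX.
case: (i == 0).
  exact: (discrete_rv_comp (fun x => x - n%:Z) (discrete_rv_psum s)).
case: (s == 0%N).
  case: (i == -1); last exact: mX.
  exact: (discrete_rv_comp (fun x => n%:Z + x)).
case: (i == -1).
  exact: (discrete_rv_comp (fun x => n%:Z + 1 - x) (discrete_rv_psum s.-1)).
case: (- s%:Z <= i); first exact: mX.
case: (i == - s%:Z - 1); last exact: mX.
exact: (discrete_rv_comp2 (fun x y => x + y - 1)).
Qed.

Lemma discrete_rv_unit_shift i : discrete_rv (fun w => unit_shift (X^~ w) i).
Proof.
pose F x w := if x == 1 then X (i + 1) w
  else if i == 0 then x - 1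
  else if i == -1 then X (-1) w + 1
  else X i w.
apply: (discrete_rv_bind (F := F) (mX 0)) => x; rewrite /F.
case: (x == 1); first exact: mX.
case: (i == 0); first exact: discrete_rv_cst.
case: (i == -1); last exact: mX.
exact: (discrete_rv_comp (fun x => x + 1)).
Qed.

Lemma measurable_cyl s v : measurable (cyl X s v).
Proof.
elim: s => [|i s IHs]; first by rewrite (_ : cyl _ _ _ = setT) //; apply/seteqP; split.
rewrite (_ : cyl _ _ _ = X i @^-1` [set v i] `&` cyl X s v).
  by apply: measurableI => //; exact: mX.
apply/seteqP; split => w; rewrite /cyl /=; first by case/andP => /eqP.
by case=> -> ->; rewrite eqxx.
Qed.

End DiscreteMeasurability.

(** * Null sets and countable partitions *)

Section Measure.
Context (R : realType) (d : measure_display) (T : measurableType d)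
        (P : probability T R).

Lemma eq_measure_off_negligible (N A B : set T) : P.-negligible N ->
  measurable A -> measurable B -> (forall w, ~ N w -> A w <-> B w) -> P A = P B.
Proof.
move=> [M [mM PM NM]] mA mB AB.
have H C : measurable C -> P C = P (C `\` M).
  move=> mC; rewrite (measureDI P mC mM) -[RHS]adde0; congr (_ + _)%E.
  apply/eqP; rewrite eq_le measure_ge0 andbT -PM.
  by apply: le_measure; rewrite ?inE//; exact: measurableI.
rewrite (H A)// (H B)//; congr (P _); apply/seteqP; split => w /= [h hM];
  by split => //; apply/AB => // /NM.
Qed.

(** The level sets of f partition the space; they are enumerated through [pickle], and a number
    coding no value contributes the empty set. *)
Lemma total_probability (U : countType) (f : T -> U) (A : set T) :
  discrete_rv f -> measurable A ->
  P A = (\sum_(0 <= n <oo)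
    P (A `&` oapp (fun u => f @^-1` [set u]) set0 (pickle_inv n)))%E.
Proof.
move=> mf mA; pose F n := A `&` oapp (fun u => f @^-1` [set u]) set0 (pickle_inv n).
have mF n : measurable (F n).
  apply: measurableI => //; case: pickle_inv => [u|] //=; exact: mf.
rewrite -[in LHS](_ : \bigcup_n F n = A).
  rewrite measure_semi_bigcup //; last exact: bigcup_measurable.
  apply/trivIsetP => i j _ _ ij; apply/seteqP; split => // w [[_ h1] [_ h2]].
  move: h1 h2; have := @pickle_invK U i; have := @pickle_invK U j.
  case: (pickle_inv i) => [u|] //=; case: (pickle_inv j) => [u'|] //= jE iE h1 h2.
  by move: ij; rewrite -iE -jE -h1 -h2 eqxx.
apply/seteqP; split => [w [n _ []] //|w Aw].
by exists (pickle (f w)) => //; split => //; rewrite pickleK_inv.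
Qed.

End Measure.

(** * Products of geometric laws *)

Section GeometricLaw.
Context (R : realType) (p : R).

Lemma geom_pmf_le0 k : k <= 0 -> geom_pmf p k = 0.
Proof. by move=> k0; rewrite /geom_pmf ltNge k0. Qed.

Lemma geom_pmfS k : geom_pmf p k.+1%:Z = (1 - p) ^+ k * p.
Proof. by []. Qed.

(** As long as both arguments stay positive, a product of two geometric weights depends only on
    their sum. *)
Lemma geom_pmf_transfer j k : 1 <= j -> 1 < k ->
  geom_pmf p (j + 1) * geom_pmf p (k - 1) = geom_pmf p j * geom_pmf p k.
Proof.
case: j => [[|j]|j] //; case: k => [[|[|k]]|k] // _ _.
rewrite (_ : _ + 1 = j.+2%:Z); last by lia.
rewrite (_ : _ - 1 = k.+1%:Z); last by lia.
by rewrite !geom_pmfS !exprS; ring.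
Qed.

Lemma prod_geom_pmf_eq0 (s : seq int) v i : i \in s -> v i <= 0 ->
  \prod_(j <- s) geom_pmf p (v j) = 0.
Proof.
move=> si vi; rewrite (big_rem i) //= geom_pmf_le0 //.
by rewrite mul0r.
Qed.

(** Inverts the branch g 0 != 1 of [unit_shift]: when v 0 != 0, [unit_shift] sends [transfer v] to
    v. *)
Definition transfer (v : int -> int) : int -> int := fun i =>
  if i == 0 then v 0 + 1 else if i == -1 then v (-1) - 1 else v i.

Lemma prod_geom_pmf_transfer (s : seq int) v : uniq s -> 0 \in s -> -1 \in s ->
  1 <= v 0 -> 1 < v (-1) ->
  \prod_(j <- s) geom_pmf p (transfer v j) = \prod_(j <- s) geom_pmf p (v j).
Proof.
move=> us s0 s1 v0 v1.
rewrite (bigD1_seq 0) //= (bigD1_seq 0 s0 us) /=.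
rewrite -big_filter -[in RHS]big_filter.
have s1' : -1 \in [seq i <- s | i != 0] by rewrite mem_filter s1.
have us' := filter_uniq (fun i => i != 0) us.
rewrite (bigD1_seq (-1)) //= (bigD1_seq (-1) s1' us') /=.
rewrite !mulrA /transfer /= geom_pmf_transfer //; congr (_ * _).
rewrite -big_filter -[in RHS]big_filter; apply: eq_big_seq => i.
by rewrite !mem_filter => /andP[/negbTE -> /andP[/negbTE -> _]].
Qed.

End GeometricLaw.

Section ProductLaw.
Context (R : realType) (d : measure_display) (T : measurableType d)
        (P : probability T R) (p : R).

(** Independence and marginals fused into one product formula, the form that a recursion on cylinder
    probabilities can propagate. *)
Definition geom_law (A : set int) (X : int -> T -> int) :=
  forall (s : seq int) (v : int -> int), uniq s -> (forall i, i \in s -> A i) ->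
    P (cyl X s v) = (\prod_(i <- s) geom_pmf p (v i))%:E.

Lemma cyl1 (X : int -> T -> int) i v : cyl X [:: i] v = X i @^-1` [set v i].
Proof.
apply/seteqP; split => w; rewrite /cyl /= andbT; first by move/eqP.
by move=> ->.
Qed.

Lemma iid_geomP A X : iid_geom P p A X <-> geom_law A X.
Proof.
split=> [[indep marg] s v us sA|law].
  rewrite indep // -prodEFin; apply: eq_big_seq => i si.
  by rewrite cyl1 marg //; exact: sA.
have marg i k : A i -> P (X i @^-1` [set k]) = (geom_pmf p k)%:E.
  move=> Ai; rewrite -(cyl1 X i (fun=> k)) law ?big_seq1 // => j.
  by rewrite inE => /eqP ->.
split=> [s v us sA|i Ai k]; last exact: marg.
rewrite law // -prodEFin; apply: eq_big_seq => i si.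
by rewrite cyl1 marg //; exact: sA.
Qed.

Lemma cyl_le (X : int -> T -> int) s v i : (forall i, discrete_rv (X i)) ->
  i \in s -> (P (cyl X s v) <= P (X i @^-1` [set v i]))%E.
Proof.
move=> mX si; apply: le_measure; rewrite ?inE.
- exact: measurable_cyl.
- exact: mX.
- by move=> w /allP /(_ i si) /eqP.
Qed.

Lemma geom_law_eqd X Y : geom_law setT X -> geom_law setT Y -> eqd P X Y.
Proof.
move=> lX lY s v.
(* [eqd] admits repeated sites and [geom_law] does not; removing duplicates leaves the cylinder
   unchanged. *)
have cylu Z : cyl Z s v = cyl Z (undup s) v.
  by apply/funext => w; rewrite /cyl /= (eq_all_r (mem_undup s)).
by rewrite !cylu lX ?undup_uniq // lY ?undup_uniq.
Qed.

Lemma eqd_off_negligible X Y N : P.-negligible N ->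
  (forall i, discrete_rv (X i)) -> (forall i, discrete_rv (Y i)) ->
  (forall w, ~ N w -> X^~ w =1 Y^~ w) -> eqd P X Y.
Proof.
move=> nN mX mY XY s v; apply: (eq_measure_off_negligible nN).
- exact: measurable_cyl.
- exact: measurable_cyl.
- move=> w /XY XYw; rewrite /cyl /=.
  by rewrite (eq_all (a2 := fun i => Y i w == v i)) // => i; rewrite XYw.
Qed.

Lemma pos_right_ae X : geom_law [set i | 0 <= i] X ->
  (forall i, discrete_rv (X i)) ->
  P.-negligible [set w | ~ pos_right (X^~ w)].
Proof.
move=> /iid_geomP[_ marg] mX.
apply: (@negligibleS _ _ _ _
  (\bigcup_(j : nat) \bigcup_(m : nat) (X j%:Z @^-1` [set - m%:Z]))).
  move=> w /= /existsNP[j hj]; exists j => //; exists `|X j%:Z w|%N => //=; lia.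
apply: negligible_bigcup => j; apply: negligible_bigcup => m.
have PX : P (X j%:Z @^-1` [set - m%:Z]) = 0%E.
  by rewrite marg //= geom_pmf_le0 //; lia.
by apply/negligibleP => //; exact: mX.
Qed.

Section Marginals.
(* Only used to know that the geometric weights sum to 1. *)
Variable Y : T -> int.
Hypothesis mY : discrete_rv Y.
Hypothesis Yp : forall k, P (Y @^-1` [set k]) = (geom_pmf p k)%:E.

(** Summing the product formula over all values at site i replaces the factor of that site by 1. *)
Lemma geom_law_drop (X : int -> T -> int) (i : int) (s : seq int) :
  (forall i, discrete_rv (X i)) -> i \notin s ->
  (forall v, P (cyl X (i :: s) v) =
    (\prod_(j <- i :: s) geom_pmf p (v j))%:E) ->
  forall v, P (cyl X s v) = (\prod_(j <- s) geom_pmf p (v j))%:E.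
Proof.
move=> mX si lX v.
pose a n : \bar R := (oapp (geom_pmf p) 0 (pickle_inv n))%:E.
have a0 n : (0 <= a n)%E.
  rewrite /a; case: pickle_inv => //= k; rewrite -Yp; exact: measure_ge0.
have suma : (\sum_(0 <= n <oo) a n = 1)%E.
  rewrite -(probability_setT P) (total_probability P mY measurableT).
  apply: eq_eseriesr => n _; rewrite setTI /a.
  by case: pickle_inv => [k|] /=; rewrite ?Yp ?measure0.
rewrite (total_probability P (mX i) (measurable_cyl mX s v)).
rewrite -[RHS]mule1 -suma -nneseriesZl //.
apply: eq_eseriesr => n _; rewrite /a.
case: pickle_inv => [k|] /=; last by rewrite setI0 measure0 mule0.
pose u j := if j == i then k else v j.
have us : {in s, u =1 v}.
  by move=> j sj; rewrite /u; case: eqP => // ji; rewrite -ji sj in si.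
rewrite (_ : _ `&` _ = cyl X (i :: s) u).
  rewrite lX big_cons -EFinM mulrC; congr (_ * _)%:E.
    by apply: eq_big_seq => j /us ->.
  by rewrite /u eqxx.
apply/seteqP; split => w /=; rewrite /cyl /= {1}/u eqxx.
  case=> /allP sv ->; rewrite eqxx /=; apply/allP => j sj.
  by rewrite us // sv.
case/andP => /eqP Xk /allP su; split => //; apply/allP => j sj.
by rewrite -us // su.
Qed.

Lemma geom_law_sub (X : int -> T -> int) (t s : seq int) :
  (forall i, discrete_rv (X i)) -> uniq (t ++ s) ->
  (forall v, P (cyl X (t ++ s) v) =
    (\prod_(j <- t ++ s) geom_pmf p (v j))%:E) ->
  forall v, P (cyl X s v) = (\prod_(j <- s) geom_pmf p (v j))%:E.
Proof.
move=> mX; elim: t => [|i t IHt] //= /andP[it ut] lX.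
by apply: IHt => //; exact: geom_law_drop lX.
Qed.

(** The one-step recursion needs 0 and -1 among the sites; they are added when missing and summed
    out afterwards. *)
Lemma geom_law_extend (A : set int) (X : int -> T -> int) :
  (forall i, discrete_rv (X i)) ->
  A 0 -> A (-1) ->
  (forall s v, uniq s -> (forall i, i \in s -> A i) -> 0 \in s -> -1 \in s ->
    P (cyl X s v) = (\prod_(j <- s) geom_pmf p (v j))%:E) ->
  geom_law A X.
Proof.
move=> mX A0 A1 lX s v us sA.
pose t := [seq i <- [:: 0; -1] | i \notin s].
have ts : uniq (t ++ s).
  rewrite cat_uniq us andbT filter_uniq //=.
  apply/hasPn => i si; rewrite mem_filter si //.
apply: (geom_law_sub mX ts) => {v} v; apply: lX => //.
- move=> i; rewrite mem_cat => /orP[|/sA //].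
  by rewrite mem_filter !inE => /andP[_ /orP[] /eqP ->].
- by rewrite mem_cat mem_filter; case: (0 \in s).
- by rewrite mem_cat mem_filter; case: (-1 \in s).
Qed.

End Marginals.

(* On [X 0 = 1] the map shifts the sequence, otherwise it transfers one unit
   from site 0 to site -1. *)
Lemma cyl_unit_shift (X : int -> T -> int) (s : seq int) v :
  (forall i, discrete_rv (X i)) ->
  0 \in s -> -1 \in s -> 1 <= v 0 ->
  P (cyl (fun i w => unit_shift (X^~ w) i) s v) =
  ((if v (-1)%R == 1%R
    then P (cyl X [seq (i + 1)%R | i <- s] (fun j => v (j - 1)%R)) else 0)
   + P (cyl X s (transfer v)))%E.
Proof.
move=> mX s0 s1 v0.
pose A := if v (-1) == 1 then cyl X [seq i + 1 | i <- s] (fun j => v (j - 1))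
  else set0.
have mA : measurable A by rewrite /A; case: ifP => // _; exact: measurable_cyl.
(* This makes the two events disjoint: X 0 = 1 on the shift event, whereas X 0 = v 0 + 1 >= 2 on the
   transfer event. *)
have A1 w : A w -> X 0 w = 1.
  rewrite /A; case: eqP => // v1; rewrite /cyl /= all_map => /allP /(_ _ s1) /=.
  by rewrite addNr sub0r v1 => /eqP.
have -> : (if v (-1) == 1
    then P (cyl X [seq i + 1 | i <- s] (fun j => v (j - 1))) else 0%E) = P A.
  by rewrite /A; case: ifP => // _; rewrite measure0.
rewrite -measureU //; first last.
- apply/seteqP; split => // w [/A1 X0 /allP /(_ _ s0) /eqP].
  by rewrite /transfer /= X0; lia.
- exact: measurable_cyl.
congr (P _); apply/seteqP; split => w.
- move=> /allP sv; case: (boolP (X 0 w == 1)) => X0; [left|right].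
    have v1 : v (-1) = 1.
      by have /eqP := sv _ s1; rewrite /unit_shift X0 addNr => <-; apply/eqP.
    rewrite /A v1 eqxx /cyl /= all_map; apply/allP => i /sv.
    by rewrite /unit_shift X0 /= addrK.
  apply/allP => i /sv; rewrite /unit_shift (negbTE X0) /transfer.
  case: (boolP (i == 0)) => [/eqP ->|_]; first by lia.
  by case: (boolP (i == -1)) => [/eqP ->|//]; lia.
- case=> [Aw|/allP sv]; apply/allP => i si.
    have X0 := A1 _ Aw; rewrite /unit_shift X0 eqxx.
    move: Aw; rewrite /A; case: eqP => // _; rewrite /cyl /= all_map.
    by move=> /allP /(_ _ si) /=; rewrite addrK.
  have X0 : X 0 w = v 0 + 1 by have /eqP := sv _ s0; rewrite /transfer.
  rewrite /unit_shift ifF; last by rewrite X0; lia.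
  have := sv _ si; rewrite /transfer.
  case: (boolP (i == 0)) => [/eqP ->|_]; first by rewrite X0; lia.
  by case: (boolP (i == -1)) => [/eqP ->|//]; lia.
Qed.

End ProductLaw.

(** * Stationarity and its converse *)

Section Stationarity.
Context (R : realType) (d : measure_display) (T : measurableType d)
        (P : probability T R) (p : R).

Lemma geom_lawW (A B : set int) (X : int -> T -> int) : B `<=` A ->
  geom_law P p A X -> geom_law P p B X.
Proof. by move=> BA lX s v us sB; apply: lX => // i /sB /BA. Qed.

Lemma geom_law_marginal (A : set int) (X : int -> T -> int) i k :
  geom_law P p A X -> A i -> P (X i @^-1` [set k]) = (geom_pmf p k)%:E.
Proof. by move=> /iid_geomP[_ marg] Ai; exact: marg. Qed.

Lemma geom_law_unit_shift (X : int -> T -> int) :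
  (forall i, discrete_rv (X i)) -> geom_law P p setT X ->
  geom_law P p setT (fun i w => unit_shift (X^~ w) i).
Proof.
move=> mX lX.
have marg0 k := geom_law_marginal (i := 0) k lX I.
have mU := discrete_rv_unit_shift mX.
apply: (geom_law_extend (mX 0) marg0 mU) => // s v us _ s0 s1.
(* If v 0 <= 0 both sides vanish, because [unit_shift] almost surely leaves a positive value at site
   0. *)
have [v0|v0] := lerP 1 (v 0); last first.
  rewrite (prod_geom_pmf_eq0 p s0); last by lia.
  rewrite -[RHS](measure0 P).
  have nN := pos_right_ae (geom_lawW (@subsetT _ _) lX) mX.
  apply: (eq_measure_off_negligible nN); [exact: measurable_cyl|by []|].
  move=> w /= /contrapT /unit_shift_pos /(_ 0%N) U0; split=> // /allP /(_ _ s0) /eqP.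
  by move: U0 => /[swap] ->; lia.
rewrite cyl_unit_shift // (lX s (transfer v)) //.
(* Below 1 every term is zero; above 1 only the transfer term remains, with the same weight; at 1
   the transfer puts 0 at site -1, so only the shift term remains. *)
have [v1|v1|v1] := ltrgtP (v (-1)) 1.
- rewrite (prod_geom_pmf_eq0 p (v := transfer v) s1); last first.
    by rewrite /transfer /=; lia.
  by rewrite (prod_geom_pmf_eq0 p (v := v) s1) ?adde0 //; lia.
- by rewrite add0e prod_geom_pmf_transfer.
- rewrite lX; last by []; last by rewrite map_inj_uniq //; exact: addIr.
  rewrite (prod_geom_pmf_eq0 p (v := transfer v) s1); last first.
    by rewrite /transfer /= v1.
  rewrite adde0 big_map; congr _%:E; apply: eq_bigr => i _.
  by rewrite addrK.
Qed.

Lemma geom_law_Phi n (X : int -> T -> int) :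
  (forall i, discrete_rv (X i)) -> geom_law P p setT X ->
  geom_law P p setT (fun i w => Phi n (X^~ w) i).
Proof.
elim: n X => [|n IHn] X mX lX s v us sT;
    have nN := pos_right_ae (geom_lawW (@subsetT _ _) lX) mX.
  rewrite (eqd_off_negligible nN (Y := X)) ?lX //; first exact: discrete_rv_Phi.
  by move=> w /= /contrapT Xp i; rewrite Phi0.
have mU := discrete_rv_unit_shift mX.
rewrite (eqd_off_negligible nN
    (Y := fun i w => Phi n (fun j => unit_shift (X^~ w) j) i)).
- exact: (IHn _ mU (geom_law_unit_shift mX lX)).
- exact: discrete_rv_Phi.
- exact: (discrete_rv_Phi mU).
- by move=> w /= /contrapT Xp i; rewrite Phi_succ.
Qed.

(** * Converse: recovering the full law from stationarity *)

Hypothesis p01 : 0 < p <= 1.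

Lemma geom_pmf_shift_le j k : 1 <= j -> geom_pmf p (j + k%:Z) <= (1 - p) ^+ k.
Proof.
case: j => [[|j]|j] // _; case/andP: p01 => p0 p1.
rewrite (_ : _ + _ = (j + k).+1%:Z) ?geom_pmfS; last by lia.
rewrite exprD mulrAC ler_piMl ?exprn_ge0 ?subr_ge0 //.
by rewrite mulr_ile1 ?exprn_ge0 ?exprn_ile1 ?subr_ge0 ?(ltW p0) // gerBl ltW.
Qed.

(** Since p > 0, the powers of 1 - p tend to 0. *)
Lemma le_expr_le0 (x : R) : (forall k, x <= (1 - p) ^+ k) -> x <= 0.
Proof.
move=> xk; rewrite leNgt; apply/negP => x0; case/andP: p01 => p0 p1.
have q1 : `|1 - p| < 1 by rewrite ger0_norm; lra.
have /cvgrPdist_lt /(_ _ x0)[k _ /(_ k (leqnn k))] /= := cvg_expr q1.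
rewrite sub0r normrN ger0_norm ?exprn_ge0 ?subr_ge0 //.
by rewrite ltNge xk.
Qed.

Variable X : int -> T -> int.
Hypothesis mX : forall i, discrete_rv (X i).
Hypothesis lX : geom_law P p [set i | 0 <= i] X.
Hypothesis statX : eqd P (fun i w => unit_shift (X^~ w) i) X.

(** Stationarity replaces the law of the image by that of X, turning the one-step formula into an
    equation for the law of X alone. *)
Lemma cyl_rec (s : seq int) v : 0 \in s -> -1 \in s -> 1 <= v 0 ->
  P (cyl X s v) =
  ((if v (-1)%R == 1%R
    then P (cyl X [seq (i + 1)%R | i <- s] (fun j => v (j - 1)%R)) else 0)
   + P (cyl X s (transfer v)))%E.
Proof. by move=> s0 s1 v0; rewrite -statX cyl_unit_shift. Qed.

(* Iterating the recursion k times pushes site 0 above k. *)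
Lemma cyl_nonpos_left (s : seq int) v : 0 \in s -> -1 \in s -> 1 <= v 0 ->
  v (-1) <= 0 -> P (cyl X s v) = 0%E.
Proof.
move=> s0 s1 v0 v1.
have bound k (u : int -> int) : 1 <= u 0 -> u (-1) <= 0 ->
    (P (cyl X s u) <= (geom_pmf p (u 0 + k%:Z))%:E)%E.
  elim: k u => [|k IHk] u u0 u1.
    by rewrite addr0 -(geom_law_marginal (i := 0) _ lX) //; exact: cyl_le.
  rewrite cyl_rec // ifF ?add0e; last by lia.
  have [t0 t1] : 1 <= transfer u 0 /\ transfer u (-1) <= 0.
    by rewrite /transfer /=; lia.
  by rewrite -addn1 addnC PoszD addrA; exact: IHk.
have fP : P (cyl X s v) \is a fin_num.
  by apply: fin_num_measure; exact: measurable_cyl.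
apply/eqP; rewrite eq_le measure_ge0 andbT -(fineK fP) lee_fin.
apply: le_expr_le0 => k; rewrite -lee_fin fineK //.
by apply: (le_trans (bound k _ v0 v1)); rewrite lee_fin geom_pmf_shift_le.
Qed.

Lemma geom_law_left m : geom_law P p [set i | - m%:Z <= i] X.
Proof.
elim: m => [|m IHm]; first by rewrite oppr0.
have marg0 k := geom_law_marginal (i := 0) k lX (lexx 0).
apply: (geom_law_extend (mX 0) marg0 mX) => [/=|/=|s v us sA s0 s1]; [lia|lia|].
have [v0|v0] := lerP 1 (v 0); last first.
  have vle : v 0 <= 0 by lia.
  rewrite (prod_geom_pmf_eq0 p s0) //; apply/eqP.
  rewrite eq_le measure_ge0 andbT -(geom_pmf_le0 p vle) -marg0.
  exact: cyl_le.
have [v1|v1] := lerP (v (-1)) 0.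
  by rewrite cyl_nonpos_left // (prod_geom_pmf_eq0 p s1).
have [j vj] : exists j : nat, v (-1) = j.+1%:Z.
  by exists (absz (v (-1))).-1; lia.
(* Induction on the value j+1 at site -1. At value 1 the transfer term has 0 at site -1 and
   vanishes, while the shift brings all sites to at least -m, where [IHm] applies. Larger values are
   lowered by [transfer], which preserves the product of weights. *)
elim: j v v0 {v1} vj => [|j IHj] v v0 vj.
  rewrite cyl_rec // ifT; last by rewrite vj.
  rewrite (cyl_nonpos_left (v := transfer v)) //; last by rewrite /transfer /= vj.
  - rewrite adde0 IHm; first last.
    + by move=> _ /mapP[i /sA /= si ->]; lia.
    + by rewrite map_inj_uniq //; exact: addIr.
    by rewrite big_map; congr _%:E; apply: eq_bigr => i _; rewrite addrK.
  - by rewrite /transfer /=; lia.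
rewrite cyl_rec // ifF ?add0e; last by lia.
rewrite IHj ?prod_geom_pmf_transfer ?vj //; rewrite /transfer /=; lia.
Qed.

Lemma geom_law_full : geom_law P p setT X.
Proof.
move=> s v us _.
apply: (geom_law_left (m := \max_(i <- s) `|i|%N)) => // i si /=.
have : (`|i| <= \max_(i <- s) `|i|)%N by exact: leq_bigmax_seq.
lia.
Qed.

End Stationarity.

Theorem theorem3p6 (R : realType) (d : measure_display) (T : measurableType d)
    (P : probability T R) (p : R) (G : int -> T -> int) :
  0 < p <= 1 ->
  (forall (i k : int), measurable (G i @^-1` [set k])) ->
  (iid_geom P p setT G <->
   (iid_geom P p [set i | 0 <= i] G /\
    forall n : nat, eqd P (fun i w => Phi n (fun j => G j w) i) G)).
Proof.
move=> p01 mG; split=> [/iid_geomP lG|[/iid_geomP lG statG]].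
  split; first by apply/iid_geomP; exact: geom_lawW lG.
  by move=> n; apply: (geom_law_eqd _ lG); exact: geom_law_Phi.
apply/iid_geomP/(geom_law_full p01 mG lG) => s v.
(* Stationarity under [Phi 1] is stationarity under [unit_shift], as the two agree wherever G is
   positive on the right, hence almost surely. *)
rewrite -(statG 1%N) (eqd_off_negligible (pos_right_ae lG mG)
  (Y := fun i w => unit_shift (G^~ w) i)) //.
- exact: discrete_rv_Phi.
- exact: discrete_rv_unit_shift.
- by move=> w /= /contrapT Gp i; rewrite Phi1.
Qed.
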